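(* Let $K$ be a field, $\lambda\in K$, and let $(A,\mu,1,\alpha,\beta)$ be a unitary BiHom-associative algebra over $K$ with $\alpha,\beta$ bijective. Let $\psi,\omega:A\to A$ be linear maps such that any two of $\alpha,\beta,\psi,\omega$ commute, $\psi(ab)=\psi(a)\psi(b)$, $\omega(ab)=\omega(a)\omega(b)$ for all $a,b\in A$, and $\psi(1)=1=\omega(1)$. Let $r=r^1\otimes r^2\in A\otimes A$ satisfy $(f\otimes f)(r)=r$ for each $f\in\{\alpha,\beta,\psi,\omega\}$. Define $$\widetilde{\Delta}_r(a)=\omega\alpha^{-1}(a)r^1\otimes\beta(r^2)-\alpha(r^1)\otimes r^2\,\psi\beta^{-1}(a)-\lambda(1\otimes\psi(a)).$$ Then the $\lambda$-BiHom-derivation $\widetilde{\Delta}_r$ is BiHom-coassociative, i.e. $(\widetilde{\Delta}_r\otimes\psi)\circ\widetilde{\Delta}_r=(\omega\otimes\widetilde{\Delta}_r)\circ\widetilde{\Delta}_r$, if and only if for all $a\in A$ $$\omega\alpha^{-1}(a)\triangleright(r_{13}r_{12}-r_{12}r_{23}+r_{23}r_{13}+\lambda r_{13})=(r_{13}r_{12}-r_{12}r_{23}+r_{23}r_{13}+\lambda r_{13})\triangleleft\psi\beta^{-1}(a).$$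
   Context: A BiHom-associative algebra $(A,\mu,\alpha,\beta)$ consists of a vector space $A$ and linear maps $\mu:A\otimes A\to A$ (written $ab$), $\alpha,\beta:A\to A$ with $\alpha\beta=\beta\alpha$, $\alpha(ab)=\alpha(a)\alpha(b)$, $\beta(ab)=\beta(a)\beta(b)$ and $\alpha(a)(bc)=(ab)\beta(c)$. It is unitary with unit $1$ if $\alpha(1)=1=\beta(1)$, $a1=\alpha(a)$, $1a=\beta(a)$ for all $a$. A linear map $\delta:A\to A\otimes A$, $\delta(a)=a_{[1]}\otimes a_{[2]}$, is a $\lambda$-BiHom-derivation if $(f\otimes f)\circ\delta=\delta\circ f$ for $f\in\{\alpha,\beta,\psi,\omega\}$ and $\delta(ab)=\omega(a)b_{[1]}\otimes\beta(b_{[2]})+\alpha(a_{[1]})\otimes a_{[2]}\psi(b)+\lambda\,\alpha\omega(a)\otimes\beta\psi(b)$. Actions of $A$ on $A\otimes A\otimes A$: $a\triangleright(x\otimes y\otimes z)=\omega(a)x\otimes\beta(y)\otimes\beta(z)$ and $(x\otimes y\otimes z)\triangleleft a=\alpha(x)\otimes\alpha(y)\otimes z\psi(a)$. With $r=r^1\otimes r^2=\bar r^1\otimes\bar r^2$ (sums suppressed), in $A\otimes A\otimes A$: $r_{12}r_{23}=\alpha(r^1)\otimes r^2\bar r^1\otimes\beta(\bar r^2)$, $\;r_{13}r_{12}=\omega(r^1)\bar r^1\otimes\beta(\bar r^2)\otimes\alpha\psi(r^2)$, $\;r_{23}r_{13}=\beta\omega(r^1)\otimes\alpha(\bar r^1)\otimes\bar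 r^2\psi(r^2)$, $\;r_{13}=\omega(r^1)\otimes1\otimes\psi(r^2)$. *)

(* Defs.v *)
From HB Require Import structures.
From mathcomp Require Import all_boot all_algebra generic_quotient.
From mathcomp Require Import boolp.
From mathcomp Require Import freeg.

Set Implicit Arguments.
Unset Strict Implicit.
Unset Printing Implicit Defensive.

Import GRing.Theory.
Local Open Scope ring_scope.
Local Open Scope quotient_scope.

Notation is_bilinear f := (bilinear_for *:%R *:%R f).

(** [tens U V] is the free vector space on [U * V] modulo the subspace
    generated by the usual bilinearity relations. *)

Section TensorProduct.
Variables (K : fieldType) (U V : lmodType K).

Notation free := {freeg (U * V)%type / K}.

Inductive tens_null : free -> Prop :=
| tens_null0 : tens_null 0
| tens_nullD x y : tens_null x -> tens_null y -> tens_null (x + y)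
| tens_nullZ c x : tens_null x -> tens_null (c *: x)
| tens_null_l c u u' v :
    tens_null (<< (c *: u + u', v) >> - (c *: << (u, v) >> + << (u', v) >>))
| tens_null_r c u v v' :
    tens_null (<< (u, c *: v + v') >> - (c *: << (u, v) >> + << (u, v') >>)).

Definition tens_nullb : {pred free} := fun x => `[< tens_null x >].

Lemma tens_nullb_closed : zmod_closed tens_nullb.
Proof.
split; first by apply/asboolP; apply: tens_null0.
move=> x y /asboolP hx /asboolP hy; apply/asboolP; apply: tens_nullD => //.
by rewrite -scaleN1r; apply: tens_nullZ.
Qed.

HB.instance Definition _ :=
  GRing.isZmodClosed.Build free tens_nullb tens_nullb_closed.

Definition tens := {ideal_quot tens_nullb}.
HB.instance Definition _ := GRing.Zmodule.on tens.

Let pi (x : free) : tens := \pi_({ideal_quot tens_nullb}) x.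

Let pi_eqP x y : reflect (pi x = pi y) `[< tens_null (x - y) >].
Proof.
have -> : `[< tens_null (x - y) >] = (x - y \in (tens_nullb : pred free)) by [].
rewrite Quotient.idealrBE; exact: eqP.
Qed.

Let piD x y : pi (x + y) = pi x + pi y.
Proof. by rewrite /pi [LHS]raddfD. Qed.

Let reprK (x : tens) : pi (repr x) = x. Proof. exact: reprK. Qed.

Definition tens_scale (c : K) (x : tens) : tens := pi (c *: repr x).

Let piZ c x : pi (c *: x) = tens_scale c (pi x).
Proof.
apply/pi_eqP/asboolP; rewrite -scalerBr; apply: tens_nullZ.
by apply/asboolP/pi_eqP; rewrite reprK.
Qed.

Let tens_scaleA c d x : tens_scale c (tens_scale d x) = tens_scale (c * d) x.
Proof. by rewrite -[x]reprK -!piZ scalerA. Qed.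

Let tens_scale1 : left_id 1 tens_scale.
Proof. by move=> x; rewrite -[x]reprK -piZ scale1r. Qed.

Let tens_scaleDr : right_distributive tens_scale +%R.
Proof.
by move=> c x y; rewrite -[x]reprK -[y]reprK -piD -!piZ -piD scalerDr.
Qed.

Let tens_scaleDl x : {morph tens_scale^~ x : c d / c + d}.
Proof. by move=> c d; rewrite -[x]reprK -!piZ -piD scalerDl. Qed.

HB.instance Definition _ := GRing.Zmodule_isLmodule.Build K tens
  tens_scaleA tens_scale1 tens_scaleDr tens_scaleDl.

Definition ptens (u : U) (v : V) : tens := pi << (u, v) >>.

Lemma ptens_bilinear : is_bilinear ptens.
Proof.
split=> [v|u] c x y; rewrite /ptens.
  have -> : c *: pi << (x, v) >> + pi << (y, v) >> =
    pi (c *: << (x, v) >> + << (y, v) >>) by rewrite piD piZ.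
  by apply/pi_eqP/asboolP; apply: tens_null_l.
have -> : c *: pi << (u, x) >> + pi << (u, y) >> =
  pi (c *: << (u, x) >> + << (u, y) >>) by rewrite piD piZ.
by apply/pi_eqP/asboolP; apply: tens_null_r.
Qed.

Section Sweedler.
Variable W : lmodType K.

(* Sweedler notation: [sweedler x (fun x1 x2 => f x1 x2)] is the sum of the
   [f x1 x2] over a chosen expression of [x] as a sum of pure tensors
   [x1 (x) x2]. For bilinear [f] it does not depend on that choice and is the
   linear map induced by [f] (lemmas [sweedler_linear], [sweedler_ptens] and
   [sweedler_unique]); it is meaningless for other [f]. *)
Definition sweedler (x : tens) (f : U -> V -> W) : W :=
  fglift (fun p : U * V => f p.1 p.2) (repr x).

Variable f : U -> V -> W.
Hypothesis f_bilinear : is_bilinear f.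

Let F := fglift (fun p : U * V => f p.1 p.2) : free -> W.

Let F_B x y : F (x - y) = F x - F y. Proof. exact: lift_is_additive. Qed.
Let F0 : F 0 = 0. Proof. by rewrite -(subrr 0) F_B subrr. Qed.
Let F_N x : F (- x) = - F x. Proof. by rewrite -sub0r F_B F0 sub0r. Qed.
Let F_D x y : F (x + y) = F x + F y.
Proof. by rewrite -[y in LHS]opprK F_B F_N opprK. Qed.
Let F1 p : F << p >> = f p.1 p.2.
Proof. by rewrite /F liftU scale1r. Qed.
Let F_Z c x : F (c *: x) = c *: F x.
Proof.
have F_sum (s : seq (U * V)) (G : U * V -> free) :
    F (\sum_(z <- s) G z) = \sum_(z <- s) F (G z).
  by elim: s => [|z s IHs]; rewrite ?big_nil ?F0 // !big_cons F_D IHs.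
rewrite -[x in RHS]freeg_sumE [_ *: _]/(fgscale c x) !F_sum scaler_sumr.
by apply: eq_bigr => z _; rewrite /F !liftU scalerA.
Qed.

Let F_null x : tens_null x -> F x = 0.
Proof.
case: f_bilinear => fl fr; elim=> [|y z _ hy _ hz|c y _ hy|c u u' v|c u v v'].
- exact: F0.
- by rewrite F_D hy hz addr0.
- by rewrite F_Z hy scaler0.
- by rewrite F_B F_D F_Z !F1 /=; have /= -> := fl v c u u'; rewrite subrr.
- by rewrite F_B F_D F_Z !F1 /= fr subrr.
Qed.

Let sweedler_pi x : sweedler (pi x) f = F x.
Proof.
apply/eqP; rewrite -subr_eq0 -F_B; apply/eqP/F_null/asboolP/pi_eqP.
exact: reprK.
Qed.

Lemma sweedler_ptens u v : sweedler (ptens u v) f = f u v.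
Proof. by rewrite sweedler_pi F1. Qed.

Lemma sweedler_linear : linear (sweedler^~ f).
Proof.
move=> c x y; rewrite -[x]reprK -[y]reprK.
have -> : c *: pi (repr x) + pi (repr y) = pi (c *: repr x + repr y).
  by rewrite piD piZ.
by rewrite !sweedler_pi F_D F_Z.
Qed.

End Sweedler.

Lemma tens_sum (x : tens) : exists s : seq (U * V),
  x = \sum_(p <- s) ptens p.1 p.2.
Proof.
rewrite -[x]reprK -[repr x]freeg_sumE.
exists [seq (coeff p (repr x) *: p.1, p.2) | p <- dom (repr x)].
elim: (dom (repr x)) => [|p s IHs].
  by rewrite !big_nil; exact: raddf0.
rewrite !big_cons piD IHs; congr (_ + _).
have := (ptens_bilinear).1 p.2 (coeff p (repr x)) p.1 0.
rewrite /= addr0 => ->.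
have -> : ptens 0 p.2 = 0.
  have := (ptens_bilinear).1 p.2 1 0 0; rewrite /= scaler0 addr0 scale1r.
  by move/eqP; rewrite -subr_eq0 opprD addNKr oppr_eq0 => /eqP.
rewrite addr0 /ptens; have -> : << coeff p (repr x) *g p >> =
   coeff p (repr x) *: << p >> :> free.
  apply/eqP/freeg_eqP => z; by rewrite coeffZ !coeffU mul1r.
by rewrite piZ; case: p.
Qed.

Lemma tens_ext (W : lmodType K) (g h : {linear tens -> W}) :
  (forall u v, g (ptens u v) = h (ptens u v)) -> g =1 h.
Proof.
move=> gh x; have [s ->] := tens_sum x.
by rewrite !linear_sum; apply: eq_bigr => p _; exact: gh.
Qed.

Lemma sweedler_unique (W : lmodType K) (f : U -> V -> W)
    (g : {linear tens -> W}) :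
  is_bilinear f -> (forall u v, g (ptens u v) = f u v) ->
  forall x, g x = sweedler x f.
Proof.
move=> bf gf.
pose h : {linear tens -> W} := HB.pack (fun x => sweedler x f)
  (GRing.isLinear.Build K tens W *:%R _ (sweedler_linear bf)).
by apply: (@tens_ext _ g h) => u v; rewrite gf /= sweedler_ptens.
Qed.

Lemma ptensPl c u u' v :
  ptens (c *: u + u') v = c *: ptens u v + ptens u' v.
Proof. exact: ptens_bilinear.1. Qed.

Lemma ptensPr c u v v' :
  ptens u (c *: v + v') = c *: ptens u v + ptens u v'.
Proof. exact: ptens_bilinear.2. Qed.

Lemma sweedler_param_linear (W X : lmodType K) (f : X -> U -> V -> W) x :
  (forall a, is_bilinear (f a)) -> (forall u v, linear (fun a => f a u v)) ->
  linear (fun a => sweedler x (f a)).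
Proof.
move=> bf lf c a b.
pose h a0 : {linear tens -> W} := HB.pack (fun x => sweedler x (f a0))
  (GRing.isLinear.Build K tens W *:%R _ (sweedler_linear (bf a0))).
apply: (@tens_ext _ (h (c *: a + b)) ((c \*: h a) \+ h b)) => u v /=.
by rewrite !sweedler_ptens // lf.
Qed.

End TensorProduct.

Notation "u \ox v" := (ptens u v) (at level 40, left associativity).

Section TensorMap.
Variables (K : fieldType) (U V U' V' : lmodType K).
Variables (f : {linear U -> U'}) (g : {linear V -> V'}).

Definition tmap (x : tens U V) : tens U' V' :=
  sweedler x (fun u v => f u \ox g v).

Lemma tmap_bilinear : is_bilinear (fun u v => f u \ox g v).
Proof. by split=> [v|u] c x y; rewrite linearP (ptensPl, ptensPr). Qed.

HB.instance Definition _ := GRing.isLinear.Build K (tens U V) (tens U' V') *:%R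
  tmap (sweedler_linear tmap_bilinear).

Lemma tmapE u v : tmap (u \ox v) = f u \ox g v.
Proof. exact: (sweedler_ptens tmap_bilinear). Qed.

End TensorMap.

Section Associator.
Variables (K : fieldType) (U V W : lmodType K).

(* The canonical identification of U (x) (V (x) W) with (U (x) V) (x) W,
   which is our choice of carrier for threefold tensor products. *)
Definition tassoc (x : tens U (tens V W)) : tens (tens U V) W :=
  sweedler x (fun u y => sweedler y (fun v w => u \ox v \ox w)).

Let in_bilinear u : is_bilinear (fun (v : V) (w : W) => (u : U) \ox v \ox w).
Proof. by split=> [w|v] c x y; rewrite ?ptensPr ?ptensPl. Qed.

Lemma tassoc_bilinear :
  is_bilinear (fun (u : U) y => sweedler y (fun (v : V) (w : W) => u \ox v \ox w)).
Proof.
split=> [y|u]; last exact: sweedler_linear.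
apply: sweedler_param_linear => // v w c x x'.
by rewrite !ptensPl.
Qed.

HB.instance Definition _ := GRing.isLinear.Build K _ _ *:%R
  tassoc (sweedler_linear tassoc_bilinear).

Lemma tassocE u v w : tassoc (u \ox (v \ox w)) = u \ox v \ox w.
Proof.
by rewrite /tassoc (sweedler_ptens tassoc_bilinear) sweedler_ptens.
Qed.

End Associator.

Section LinearInverse.
Variables (K : fieldType) (U V : lmodType K) (f : {linear U -> V}).
Hypothesis f_bij : bijective f.

Lemma linv_subproof : exists g : V -> U, cancel f g /\ cancel g f.
Proof. by case: f_bij => g fK gK; exists g. Qed.

Definition linv : V -> U := sval (cid linv_subproof).

Lemma linvK : cancel f linv. Proof. by case: (svalP (cid linv_subproof)). Qed.
Lemma linvKV : cancel linv f. Proof. by case: (svalP (cid linv_subproof)). Qed.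

HB.instance Definition _ := GRing.isLinear.Build K V U *:%R
  linv (GRing.can2_linear linvK linvKV).

End LinearInverse.

Section BiHom.
Variables (K : fieldType) (A : lmodType K).
Variable mu : {linear tens A A -> A}.
Local Notation "x ** y" := (mu (x \ox y)) (at level 39, left associativity).

Definition multiplicative_for (f : A -> A) := forall a b, f (a ** b) = f a ** f b.

Record bihom_associative (alpha beta : {linear A -> A}) : Prop := {
  bihom_comm : forall a, alpha (beta a) = beta (alpha a);
  bihom_alphaM : multiplicative_for alpha;
  bihom_betaM : multiplicative_for beta;
  bihom_assoc : forall a b c, alpha a ** (b ** c) = (a ** b) ** beta c
}.

Record bihom_unit (one : A) (alpha beta : {linear A -> A}) : Prop := {
  bihom_alpha1 : alpha one = one;
  bihom_beta1 : beta one = one;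
  bihom_mul1 : forall a, a ** one = alpha a;
  bihom_1mul : forall a, one ** a = beta a
}.

Variables (lambda : K) (one : A) (alpha beta psi omega : {linear A -> A}).

Record bihom_derivation (delta : {linear A -> tens A A}) : Prop := {
  bihom_der_alpha : tmap alpha alpha \o delta =1 delta \o alpha;
  bihom_der_beta : tmap beta beta \o delta =1 delta \o beta;
  bihom_der_psi : tmap psi psi \o delta =1 delta \o psi;
  bihom_der_omega : tmap omega omega \o delta =1 delta \o omega;
  bihom_derM : forall a b, delta (a ** b) =
    sweedler (delta b) (fun b1 b2 => (omega a ** b1) \ox beta b2)
    + sweedler (delta a) (fun a1 a2 => alpha a1 \ox (a2 ** psi b))
    + lambda *: (alpha (omega a) \ox beta (psi b))
}.

Definition bihom_coassociative (delta : {linear A -> tens A A}) : Prop :=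
  tmap delta psi \o delta =1 @tassoc K A A A \o tmap omega delta \o delta.

Notation tens3 := (tens (tens A A) A).

Definition lact (a : A) (t : tens3) : tens3 :=
  sweedler t (fun xy z =>
    sweedler xy (fun x y => (omega a ** x) \ox beta y) \ox beta z).

Definition ract (t : tens3) (a : A) : tens3 :=
  sweedler t (fun xy z =>
    sweedler xy (fun x y => alpha x \ox alpha y) \ox (z ** psi a)).

(* Below, [r1 (x) r2] and [s1 (x) s2] are two independent copies of [r]. *)
Definition r12r23 (r : tens A A) : tens3 :=
  sweedler r (fun r1 r2 => sweedler r (fun s1 s2 =>
    alpha r1 \ox (r2 ** s1) \ox beta s2)).

Definition r13r12 (r : tens A A) : tens3 :=
  sweedler r (fun r1 r2 => sweedler r (fun s1 s2 =>
    (omega r1 ** s1) \ox beta s2 \ox alpha (psi r2))).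

Definition r23r13 (r : tens A A) : tens3 :=
  sweedler r (fun r1 r2 => sweedler r (fun s1 s2 =>
    beta (omega r1) \ox alpha s1 \ox (s2 ** psi r2))).

Definition r13 (r : tens A A) : tens3 :=
  sweedler r (fun r1 r2 => omega r1 \ox one \ox psi r2).

Definition aybe (r : tens A A) : tens3 :=
  r13r12 r - r12r23 r + r23r13 r + lambda *: r13 r.

Section Coproduct.
Hypotheses (alpha_bij : bijective alpha) (beta_bij : bijective beta).
Variable r : tens A A.

Definition Delta (a : A) : tens A A :=
  sweedler r (fun r1 r2 => (omega (linv alpha_bij a) ** r1) \ox beta r2)
  - sweedler r (fun r1 r2 => alpha r1 \ox (r2 ** psi (linv beta_bij a)))
  - lambda *: (one \ox psi a).

Lemma Delta_linear : linear Delta.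
Proof.
move=> c a b; rewrite /Delta.
have hl x : is_bilinear (fun r1 r2 => (x ** r1) \ox beta r2).
  by split=> [r2|r1] d y z; rewrite ?ptensPr !linearP ?ptensPl ?ptensPr.
have hr x : is_bilinear (fun r1 r2 => alpha r1 \ox (r2 ** x)).
  by split=> [r2|r1] d y z; rewrite ?ptensPl !linearP ?ptensPl ?linearP ?ptensPr.
have Dl u v : linear (fun x =>
    (omega (linv alpha_bij x) ** u) \ox beta v).
  by move=> d y z; rewrite !linearP ptensPl linearP ptensPl.
have Dr u v : linear (fun x => alpha u \ox (v ** psi (linv beta_bij x))).
  by move=> d y z; rewrite !linearP ptensPr linearP ptensPr.
rewrite (sweedler_param_linear r (fun x => hl _) Dl).
rewrite (sweedler_param_linear r (fun x => hr _) Dr).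
rewrite linearP ptensPr !scalerDr !scalerN !scalerA [c * lambda]mulrC.
by rewrite !opprD [RHS]addrACA [X in _ = X + _]addrACA.
Qed.

HB.instance Definition _ := GRing.isLinear.Build K A (tens A A) *:%R
  Delta Delta_linear.

End Coproduct.

End BiHom.

(* Main.v *)
(** Both composites in the coassociativity identity expand into expressions
    quadratic in [r]. Since [r] is invariant under the four structure maps, each
    summand can be twisted by them until the BiHom-associativity law applies.
    The terms then pair off with the two sides of the balance condition and the
    others cancel, so that the coassociativity defect at [a] is the difference
    of the two actions on the Yang-Baxter element. *)

Require Import Defs.
From HB Require Import structures.
From mathcomp Require Import all_boot all_algebra.
From mathcomp Require Import boolp.

Set Implicit Arguments.
Unset Strict Implicit.
Unset Printing Implicit Defensive.

Import GRing.Theory.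
Local Open Scope ring_scope.

(** Gives maps without a canonical linear structure, such as [sweedler^~ F], access to the lemmas on
    linear maps. *)
Definition linear_of (K : fieldType) (U V : lmodType K) (f : U -> V)
    (lf : linear f) : {linear U -> V} :=
  HB.pack f (GRing.isLinear.Build K U V *:%R f lf).

(** * Sums over an explicit list of pure tensors *)

Section Ssum.
Variables (K : fieldType) (U V : lmodType K) (s : seq (U * V)).

(* Unlike [sweedler], this commutes with linear maps even when [F] is not
   bilinear. *)
Definition ssum (W : lmodType K) (F : U -> V -> W) : W :=
  \sum_(p <- s) F p.1 p.2.

(** By [tens_sum] every tensor has this form, so [r] may be given by a list. *)
Definition tens_of : tens U V := ssum (@ptens K U V).

Lemma eq_ssum (W : lmodType K) (F G : U -> V -> W) :
  (forall x y, F x y = G x y) -> ssum F = ssum G.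
Proof. by move=> FG; apply: eq_bigr => p _. Qed.

Lemma ssumB (W : lmodType K) (F G : U -> V -> W) :
  ssum (fun x y => F x y - G x y) = ssum F - ssum G.
Proof. by rewrite /ssum big_split sumrN. Qed.

Lemma ssumZ (W : lmodType K) c (F : U -> V -> W) :
  ssum (fun x y => c *: F x y) = c *: ssum F.
Proof. by rewrite /ssum scaler_sumr. Qed.

Lemma linear_ssum (W X : lmodType K) (f : {linear W -> X}) (F : U -> V -> W) :
  f (ssum F) = ssum (fun x y => f (F x y)).
Proof. exact: linear_sum. Qed.

Lemma ptens_ssuml (W X : lmodType K) (F : U -> V -> W) (z : X) :
  ssum F \ox z = ssum (fun x y => F x y \ox z).
Proof.
have lz : linear (fun w : W => w \ox z) by move=> c u u'; exact: ptensPl.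
exact: (linear_ssum (linear_of lz)).
Qed.

Lemma ptens_ssumr (W X : lmodType K) (F : U -> V -> W) (z : X) :
  z \ox ssum F = ssum (fun x y => z \ox F x y).
Proof.
have lz : linear (fun w : W => z \ox w) by move=> c u u'; exact: ptensPr.
exact: (linear_ssum (linear_of lz)).
Qed.

Lemma ptensBl (W X : lmodType K) (x y : W) (z : X) :
  (x - y) \ox z = x \ox z - y \ox z.
Proof. by rewrite addrC -scaleN1r ptensPl scaleN1r addrC. Qed.

Lemma ptensBr (W X : lmodType K) (x y : W) (z : X) :
  z \ox (x - y) = z \ox x - z \ox y.
Proof. by rewrite addrC -scaleN1r ptensPr scaleN1r addrC. Qed.

Lemma ptensZl (W X : lmodType K) c (x : W) (z : X) :
  (c *: x) \ox z = c *: (x \ox z).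
Proof.
(* With [0] written as [0 - 0], the extra tensor becomes a difference of equal terms. *)
by have := ptensPl c x 0 z; rewrite -{2}(subrr 0) ptensBl subrr !addr0.
Qed.

Lemma ptensZr (W X : lmodType K) c (x : W) (z : X) :
  z \ox (c *: x) = c *: (z \ox x).
Proof.
by have := ptensPr c z x 0; rewrite -{2}(subrr 0) ptensBr subrr !addr0.
Qed.

Lemma sweedler_ssum (W : lmodType K) (F : U -> V -> W) :
  is_bilinear F -> sweedler tens_of F = ssum F.
Proof.
move=> bF; rewrite -[LHS]/(linear_of (sweedler_linear bF) _) linear_ssum.
apply: eq_ssum => x y.
exact: sweedler_ptens.
Qed.

(** A sum of bilinear maps is bilinear, so once the inner copy is expanded the outer one can be
    too. *)
Lemma sweedler_ssum2 (W : lmodType K) (F : U -> V -> U -> V -> W) :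
  (forall x y, is_bilinear (F x y)) ->
  (forall u v, is_bilinear (fun x y => F x y u v)) ->
  sweedler tens_of (fun x y => sweedler tens_of (F x y)) =
  ssum (fun x y => ssum (F x y)).
Proof.
move=> bF bF'.
have -> : (fun x y => sweedler tens_of (F x y)) = fun x y => ssum (F x y).
  by apply/funext => x; apply/funext => y; rewrite sweedler_ssum.
apply: sweedler_ssum; split=> [v|u] c x y; rewrite /= /ssum scaler_sumr.
  by rewrite -big_split; apply: eq_bigr => p _; exact: (bF' p.1 p.2).1.
by rewrite -big_split; apply: eq_bigr => p _; exact: (bF' p.1 p.2).2.
Qed.

End Ssum.

Lemma linear_ssumBB (K : fieldType) (U V W X : lmodType K) (s : seq (U * V))
    (f : {linear W -> X}) (F G : U -> V -> W) c n :
  f (ssum s F - ssum s G - c *: n) =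
  ssum s (fun x y => f (F x y)) - ssum s (fun x y => f (G x y)) - c *: f n.
Proof. by rewrite !linearB linearZ !linear_ssum. Qed.

Lemma linear_ssum2 (K : fieldType) (U V U' V' W X : lmodType K)
    (s : seq (U * V)) (t : seq (U' * V'))
    (f : {linear W -> X}) (F : U -> V -> U' -> V' -> W) :
  f (ssum s (fun x y => ssum t (F x y))) =
  ssum s (fun x y => ssum t (fun u v => f (F x y u v))).
Proof. by rewrite linear_ssum; apply: eq_ssum => x y; exact: linear_ssum. Qed.

Lemma exchange_ssum (K : fieldType) (U V W : lmodType K) (s t : seq (U * V))
    (F : U -> V -> U -> V -> W) :
  ssum s (fun x y => ssum t (F x y)) =
  ssum t (fun u v => ssum s (fun x y => F x y u v)).
Proof. exact: exchange_big. Qed.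

(** * Invariance of the tensor as a twisting rule *)

Section Twist.
Variables (K : fieldType) (A W : lmodType K) (s : seq (A * A)).
Local Notation invariant h := (tmap h h (tens_of s) = tens_of s).

Lemma invariant_id : invariant idfun.
Proof. by rewrite linear_ssum; apply: eq_ssum => x y; rewrite /= tmapE. Qed.

Lemma invariant_comp (f g : {linear A -> A}) :
  invariant f -> invariant g -> invariant (f \o g).
Proof.
move=> fr gr; rewrite -[RHS]fr -[in RHS]gr !linear_ssum.
by apply: eq_ssum => x y; rewrite /= !tmapE.
Qed.

(** The two sums are the values of the linear map induced by [F] at the tensor and at its image
    under [tmap h h], which coincide. *)
Lemma twist (h : {linear A -> A}) (F : A -> A -> W) :
  invariant h -> is_bilinear F ->
  ssum s F = ssum s (fun x y => F (h x) (h y)).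
Proof.
move=> hr bF.
rewrite -(sweedler_ssum s bF) -{1}hr /tmap sweedler_ssum; last first.
  exact: tmap_bilinear.
rewrite -[LHS]/(linear_of (sweedler_linear bF) _) linear_ssum.
apply: eq_ssum => x y; exact: sweedler_ptens.
Qed.

(** The two copies are independent: the inner one is twisted first, then exchanging the sums makes
    the outer one inner. *)
Lemma twist2 (h k : {linear A -> A}) (F : A -> A -> A -> A -> W) :
  invariant h -> invariant k ->
  (forall x y, is_bilinear (F x y)) ->
  (forall u v, is_bilinear (fun x y => F x y u v)) ->
  ssum s (fun x y => ssum s (F x y)) =
  ssum s (fun x y => ssum s (fun u v => F (h x) (h y) (k u) (k v))).
Proof.
move=> hr kr bF bF'.
under [LHS]eq_ssum => x y do rewrite (twist kr (bF x y)).
rewrite exchange_ssum [RHS]exchange_ssum; apply: eq_ssum => u v.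
exact: (twist hr (bF' _ _)).
Qed.

End Twist.


(** * The two actions on threefold tensors *)

Section BiHomActions.
Variables (K : fieldType) (A : lmodType K) (mu : {linear tens A A -> A}).
Variables alpha beta psi omega : {linear A -> A}.
Local Notation "x ** y" := (mu (x \ox y)) (at level 39, left associativity).

Lemma mul_linearl a : linear (fun x => a ** x).
Proof. by move=> c x y; rewrite ptensPr linearP. Qed.

Lemma mul_linearr a : linear (fun x => x ** a).
Proof. by move=> c x y; rewrite ptensPl linearP. Qed.

Local Notation lmul a := (linear_of (mul_linearl a)).
Local Notation rmul a := (linear_of (mul_linearr a)).

(** Both actions unfold to tensor products of linear maps, and so inherit linearity from [tmap]. *)
Lemma lact_tmap a :
  lact mu beta omega a = tmap (tmap (lmul (omega a)) beta) beta.
Proof. by []. Qed.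

Lemma ract_tmap a :
  (ract mu alpha psi)^~ a = tmap (tmap alpha alpha) (rmul (psi a)).
Proof. by []. Qed.

Lemma lact_linear a : linear (lact mu beta omega a).
Proof. by move=> c x y; rewrite lact_tmap linearP. Qed.

Lemma ract_linear a : linear ((ract mu alpha psi)^~ a).
Proof. exact: (linearP (tmap (tmap alpha alpha) (rmul (psi a)))). Qed.

Lemma lactE a x y z : lact mu beta omega a (x \ox y \ox z) =
  (omega a ** x) \ox beta y \ox beta z.
Proof. by rewrite lact_tmap tmapE /= tmapE. Qed.

Lemma ractE a x y z : ract mu alpha psi (x \ox y \ox z) a =
  alpha x \ox alpha y \ox (z ** psi a).
Proof.
by rewrite -[LHS]/((ract mu alpha psi)^~ a _) ract_tmap tmapE /= tmapE.
Qed.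

Lemma lact_ssum a (s : seq (A * A)) F :
  lact mu beta omega a (ssum s F) =
  ssum s (fun x y => lact mu beta omega a (F x y)).
Proof. exact: (linear_ssum s (linear_of (lact_linear a))). Qed.

Lemma ract_ssum a (s : seq (A * A)) F :
  ract mu alpha psi (ssum s F) a =
  ssum s (fun x y => ract mu alpha psi (F x y) a).
Proof. exact: (linear_ssum s (linear_of (ract_linear a))). Qed.

Lemma lact_ssum2 a (s : seq (A * A)) F :
  lact mu beta omega a (ssum s (fun x y => ssum s (F x y))) =
  ssum s (fun x y => ssum s (fun u v => lact mu beta omega a (F x y u v))).
Proof. exact: (linear_ssum2 s s (linear_of (lact_linear a))). Qed.

Lemma ract_ssum2 a (s : seq (A * A)) F :
  ract mu alpha psi (ssum s (fun x y => ssum s (F x y))) a =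
  ssum s (fun x y => ssum s (fun u v => ract mu alpha psi (F x y u v) a)).
Proof. exact: (linear_ssum2 s s (linear_of (ract_linear a))). Qed.

End BiHomActions.

Ltac solve_bilinear :=
  move=> *; split=> [?|?] ? ? ? /=;
  by rewrite ?lactE ?ractE !(linearP, ptensPl, ptensPr).

(** * The map [Delta_r] and its derivation property *)

Section Coassociativity.
Variables (K : fieldType) (lambda : K) (A : lmodType K).
Variables (mu : {linear tens A A -> A}) (one : A).
Variables alpha beta psi omega : {linear A -> A}.
Hypotheses (A_assoc : bihom_associative mu alpha beta)
  (A_unit : bihom_unit mu one alpha beta)
  (alpha_bij : bijective alpha) (beta_bij : bijective beta)
  (alpha_psi : forall a, alpha (psi a) = psi (alpha a))
  (alpha_omega : forall a, alpha (omega a) = omega (alpha a))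
  (beta_psi : forall a, beta (psi a) = psi (beta a))
  (beta_omega : forall a, beta (omega a) = omega (beta a))
  (psi_omega : forall a, psi (omega a) = omega (psi a))
  (psiM : multiplicative_for mu psi) (omegaM : multiplicative_for mu omega)
  (psi1 : psi one = one) (omega1 : omega one = one).
Variable s : seq (A * A).
Hypotheses (r_alpha : tmap alpha alpha (tens_of s) = tens_of s)
  (r_beta : tmap beta beta (tens_of s) = tens_of s)
  (r_psi : tmap psi psi (tens_of s) = tens_of s)
  (r_omega : tmap omega omega (tens_of s) = tens_of s).

Local Notation "x ** y" := (mu (x \ox y)) (at level 39, left associativity).
Local Notation S F := (ssum s F).

Let alphaM := bihom_alphaM A_assoc.
Let betaM := bihom_betaM A_assoc.
Let assoc := bihom_assoc A_assoc.
Let homM := (alphaM, betaM, psiM, omegaM).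
(** Oriented towards the order [omega], [psi], [beta], [alpha] from the outside in, so that repeated
    rewriting gives a normal form. *)
Let homC := (bihom_comm A_assoc, alpha_psi, alpha_omega, beta_psi, beta_omega,
  psi_omega).
Let hom1 := (bihom_alpha1 A_unit, bihom_beta1 A_unit, psi1, omega1).

Local Notation Delta_r :=
  (Delta mu lambda one psi omega alpha_bij beta_bij (tens_of s)).

(** At such an argument both inverses disappear, since [alpha] and [beta] commute; by
    [alpha_beta_surj] every element has this form. *)
Lemma DeltaE c : Delta_r (alpha (beta c)) =
  S (fun x y => (omega (beta c) ** x) \ox beta y)
  - S (fun x y => alpha x \ox (y ** psi (alpha c)))
  - lambda *: (one \ox psi (alpha (beta c))).
Proof.
rewrite /Delta linvK (bihom_comm A_assoc) linvK !sweedler_ssum //.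
all: solve_bilinear.
Qed.

Lemma alpha_beta_surj a : exists c, a = alpha (beta c).
Proof.
by exists (linv beta_bij (linv alpha_bij a)); rewrite !linvKV.
Qed.

(** The two sums in [Delta_r] get independent twists [h] and [k], chosen at each use to suit what
    follows. *)
Lemma tmap_Delta (B C : lmodType K) (f : {linear A -> B}) (g : {linear A -> C})
    (h k : {linear A -> A}) c :
  tmap h h (tens_of s) = tens_of s -> tmap k k (tens_of s) = tens_of s ->
  tmap f g (Delta_r (alpha (beta c))) =
  S (fun x y => f (omega (beta c) ** h x) \ox g (beta (h y)))
  - S (fun x y => f (alpha (k x)) \ox g (k y ** psi (alpha c)))
  - lambda *: (f one \ox g (psi (alpha (beta c)))).
Proof.
move=> hr kr; rewrite DeltaE linear_ssumBB /= tmapE; congr (_ - _ - _).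
  under eq_ssum => x y do rewrite tmapE.
  by rewrite (twist hr) //; solve_bilinear.
under eq_ssum => x y do rewrite tmapE.
by rewrite (twist kr) //; solve_bilinear.
Qed.

(** By the unit laws and invariance under [beta] and [alpha], both sums equal the tensor itself and
    cancel. *)
Lemma Delta1 : Delta_r one = - lambda *: (one \ox one).
Proof.
have beta_r : S (fun x y => (one ** x) \ox beta y) = tens_of s.
  rewrite -[RHS]r_beta linear_ssum; apply: eq_ssum => x y.
  by rewrite /= tmapE (bihom_1mul A_unit).
have alpha_r : S (fun x y => alpha x \ox (y ** one)) = tens_of s.
  rewrite -[RHS]r_alpha linear_ssum; apply: eq_ssum => x y.
  by rewrite /= tmapE (bihom_mul1 A_unit).
have := DeltaE one; rewrite !hom1 => ->.
by rewrite beta_r alpha_r subrr sub0r scaleNr.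
Qed.

Lemma Delta_comm (f : {linear A -> A}) :
  tmap f f (tens_of s) = tens_of s -> multiplicative_for mu f -> f one = one ->
  (forall a, f (alpha a) = alpha (f a)) ->
  (forall a, f (beta a) = beta (f a)) ->
  (forall a, f (psi a) = psi (f a)) ->
  (forall a, f (omega a) = omega (f a)) ->
  tmap f f \o Delta_r =1 Delta_r \o f.
Proof.
move=> fr fM f1 fa fb fp fo a; have [c ->] := alpha_beta_surj a.
rewrite /= (tmap_Delta _ _ _ (invariant_id s) (invariant_id s)) fa fb DeltaE /=.
rewrite f1 !(fp, fa, fb); congr (_ - _ - _).
  rewrite [RHS](twist fr); last by solve_bilinear.
  by apply: eq_ssum => x y; rewrite fM !(fo, fb).
rewrite [RHS](twist fr); last by solve_bilinear.
by apply: eq_ssum => x y; rewrite fM !(fp, fa).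
Qed.

Lemma Delta_derivation :
  bihom_derivation mu lambda alpha beta psi omega Delta_r.
Proof.
split.
- by apply: Delta_comm => //; rewrite ?hom1 // => a; rewrite homC.
- by apply: Delta_comm => //; rewrite ?hom1 // => a; rewrite homC.
- by apply: Delta_comm => // a; rewrite homC.
- by apply: Delta_comm => // a; rewrite homC.
move=> a b; have [c ->] := alpha_beta_surj a; have [d ->] := alpha_beta_surj b.
rewrite -alphaM -betaM /= DeltaE; set a' := alpha (beta c).
set b' := alpha (beta d).
rewrite -[sweedler (Delta_r b') _]
  /(tmap (linear_of (mul_linearl mu (omega a'))) beta _).
rewrite -[sweedler (Delta_r a') _]
  /(tmap alpha (linear_of (mul_linearr mu (psi b'))) _).
rewrite !(tmap_Delta _ _ _ (invariant_id s) (invariant_id s)) /=.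
rewrite (bihom_mul1 A_unit) hom1.
(* Twisting by [beta] supplies the outer [beta] that associativity asks for; the next sum uses
   [alpha] likewise. *)
have -> : S (fun x y => (omega (beta (c ** d)) ** x) \ox beta y) =
    S (fun x y => (omega a' ** (omega (beta d) ** x)) \ox beta (beta y)).
  rewrite (twist r_beta) /=; last by solve_bilinear.
  by apply: eq_ssum => x y; rewrite !homM -assoc /a' !homC.
have -> : S (fun x y => alpha x \ox (y ** psi (alpha (c ** d)))) =
    S (fun x y => alpha (alpha x) \ox ((y ** psi (alpha c)) ** psi b')).
  rewrite (twist r_alpha) /=; last by solve_bilinear.
  by apply: eq_ssum => x y; rewrite !homM assoc /b' !homC.
have -> : S (fun x y => (omega a' ** alpha x) \ox beta (y ** psi (alpha d))) =
    S (fun x y => alpha (omega (beta c) ** x) \ox (beta y ** psi b')).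
  by apply: eq_ssum => x y; rewrite /a' /b' !homM !homC.
(* The mixed sums cancel, and the added [lambda] term cancels the one that [one] contributes through
   [Delta_r b']. *)
by rewrite [RHS]addrAC subrK !addrA subrK !homM.
Qed.

(** Mostly read from right to left, like [Delta_ptensr]: three terms are collected into one
    [Delta_r]. *)
Lemma Delta_ptensl c (z : A) : Delta_r (alpha (beta c)) \ox z =
  S (fun u v => (omega (beta c) ** u) \ox beta v \ox z)
  - S (fun u v => alpha u \ox (v ** psi (alpha c)) \ox z)
  - lambda *: (one \ox psi (alpha (beta c)) \ox z).
Proof. by rewrite DeltaE !ptensBl ptensZl !ptens_ssuml. Qed.

Lemma Delta_ptensr c (z : A) : tassoc (z \ox Delta_r (alpha (beta c))) =
  S (fun u v => z \ox (omega (beta c) ** u) \ox beta v)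
  - S (fun u v => z \ox alpha u \ox (v ** psi (alpha c)))
  - lambda *: (z \ox one \ox psi (alpha (beta c))).
Proof.
rewrite DeltaE !ptensBr ptensZr !ptens_ssumr linear_ssumBB /= tassocE.
by congr (_ - _ - _); apply: eq_ssum => u v; rewrite tassocE.
Qed.

(** * Matching the terms of the two composites *)

Section Terms.
(* The identities are evaluated at [a = alpha (beta (alpha (beta c)))], an
   arbitrary element, so that no inverse of [alpha] or [beta] appears. *)
Variable c : A.
Let d := alpha (beta c).
Local Notation act_l := (lact mu beta omega (omega (beta d))).
Local Notation act_r t := (ract mu alpha psi t (psi (alpha d))).
Local Notation XX := (r13r12 mu alpha beta psi omega (tens_of s)).
Local Notation YY := (r12r23 mu alpha beta (tens_of s)).
Local Notation ZZ := (r23r13 mu alpha beta psi omega (tens_of s)).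
Local Notation WW := (r13 one psi omega (tens_of s)).

(* The only quadratic term common to both composites: associativity moves the
   middle factor across (lemma [crossE]). *)
Let cross := S (fun x y => S (fun u v =>
  alpha u \ox (v ** psi (alpha (omega (beta c) ** x)))
    \ox psi (beta (alpha (beta y))))).

(** Three factors meet in one slot here, in [ract_r23r13] and in [crossE], so these need
    associativity; the other quadratic identities only move structure maps. *)
Let lact_r13r12 : act_l XX = S (fun x y => S (fun u v =>
  (omega (beta (omega (beta c) ** x)) ** u) \ox beta v
    \ox psi (beta (alpha (beta y))))).
Proof.
rewrite /r13r12 sweedler_ssum2; try solve_bilinear.
rewrite lact_ssum2.
rewrite (twist2 r_beta (invariant_id s)) /=; try solve_bilinear.
rewrite [RHS](twist2 (invariant_id s) r_beta) /=; try solve_bilinear.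
apply: eq_ssum => x y; apply: eq_ssum => u v.
by rewrite lactE /d !homM -assoc !homC.
Qed.

(** The maps of [h k] twist the left side and those of [h' k'] the right, outer copy first, so that
    the summands can be compared one by one. *)
Ltac match_terms h k h' k' :=
  rewrite (twist2 h k) /=; try solve_bilinear;
  rewrite [RHS](twist2 h' k') /=; try solve_bilinear;
  apply: eq_ssum => x y; apply: eq_ssum => u v; rewrite ?lactE ?ractE /d.

Let ract_r13r12 : act_r XX = S (fun x y => S (fun u v =>
  (omega (beta x) ** u) \ox beta v \ox psi (beta y ** psi (alpha d)))).
Proof.
rewrite /r13r12 sweedler_ssum2 ?ract_ssum2; try solve_bilinear.
match_terms r_beta (invariant_id s) r_alpha r_alpha.
by rewrite !homM !homC.
Qed.

Let ract_r12r23 : act_r YY = S (fun x y => S (fun u v =>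
  alpha u \ox (v ** psi (alpha x)) \ox psi (beta y ** psi (alpha d)))).
Proof.
rewrite /r12r23 sweedler_ssum2 ?ract_ssum2; try solve_bilinear.
(* The pair [(u, v)] on the right plays the role of the outer copy in [r12r23]. *)
rewrite [RHS]exchange_ssum.
match_terms (invariant_id s) r_psi r_alpha (invariant_id s).
by rewrite !homM !homC.
Qed.

Let lact_r12r23 : act_l YY = S (fun x y => S (fun u v =>
  omega (omega (beta d) ** alpha x) \ox (omega (beta y) ** u) \ox beta v)).
Proof.
rewrite /r12r23 sweedler_ssum2 ?lact_ssum2; try solve_bilinear.
match_terms r_omega (invariant_id s) (invariant_id s) r_beta.
by rewrite !homM !homC.
Qed.

Let lact_r23r13 : act_l ZZ = S (fun x y => S (fun u v =>
  omega (omega (beta d) ** alpha x) \ox alpha u \ox (v ** psi (alpha y)))).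
Proof.
rewrite /r23r13 sweedler_ssum2 ?lact_ssum2; try solve_bilinear.
match_terms r_alpha (invariant_id s) r_beta r_beta.
by rewrite !homM !homC.
Qed.

Let ract_r23r13 : act_r ZZ = S (fun x y => S (fun u v =>
  omega (alpha (alpha (beta x))) \ox alpha u
    \ox (v ** psi (alpha (y ** psi (alpha c)))))).
Proof.
rewrite /r23r13 sweedler_ssum2 ?ract_ssum2; try solve_bilinear.
match_terms r_alpha (invariant_id s) (invariant_id s) r_alpha.
by rewrite !homM assoc !homC.
Qed.

Let crossE : cross = S (fun x y => S (fun u v =>
  omega (alpha (alpha (beta x))) \ox
    (omega (beta (y ** psi (alpha c))) ** u) \ox beta v)).
Proof.
rewrite /cross exchange_ssum.
(* The twist by [alpha] on the left prepares the first middle factor for associativity, which then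
   puts a [beta] on the last; the remaining twists balance the maps in all slots. *)
match_terms (invariant_comp r_alpha (invariant_comp r_omega r_beta))
  (invariant_id s)
  (invariant_id s) (invariant_comp r_alpha (invariant_comp r_beta r_psi)).
by rewrite !homM assoc !homC.
Qed.

Let lact_r13 : act_l WW = S (fun x y =>
  omega (omega (beta d) ** alpha x) \ox one \ox psi (alpha (beta y))).
Proof.
rewrite /r13 sweedler_ssum ?lact_ssum; try solve_bilinear.
rewrite (twist r_alpha) /=; try solve_bilinear.
by apply: eq_ssum => x y; rewrite lactE !hom1 !homM !homC.
Qed.

Let ract_r13 : act_r WW = S (fun x y =>
  omega (alpha (alpha (beta x))) \ox one
    \ox psi (alpha (beta (y ** psi (alpha c))))).
Proof.
rewrite /r13 sweedler_ssum ?ract_ssum; try solve_bilinear.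
rewrite (twist (invariant_comp r_alpha r_beta)) /=; try solve_bilinear.
by apply: eq_ssum => x y; rewrite ractE !hom1 /d !homM !homC.
Qed.

(** With [one_r], brings the [lambda] terms of the first composite to the form they take in
    [one \ox Delta_r (psi a)], which occurs in the second. *)
Let one_l : S (fun x y => one \ox psi (alpha (beta (omega (beta c) ** x)))
    \ox psi (beta (alpha (beta y)))) =
  S (fun x y => one \ox (omega (beta (psi d)) ** x) \ox beta y).
Proof.
rewrite [RHS](twist (invariant_comp r_alpha (invariant_comp r_beta r_psi))) /=;
  try solve_bilinear.
by apply: eq_ssum => x y; rewrite /d !homM !homC.
Qed.

Let one_r : S (fun x y => one \ox psi (alpha (beta x))
    \ox psi (beta y ** psi (alpha d))) =
  S (fun x y => one \ox alpha x \ox (y ** psi (alpha (psi d)))).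
Proof.
rewrite [RHS](twist (invariant_comp r_beta r_psi)) /=; try solve_bilinear.
by apply: eq_ssum => x y; rewrite !homM !homC.
Qed.

Let a := alpha (beta d).
Let U := S (fun x y => one \ox (omega (beta (psi d)) ** x) \ox beta y).
Let V := S (fun x y => one \ox alpha x \ox (y ** psi (alpha (psi d)))).

Let coassoc_lhs : tmap Delta_r psi (Delta_r a) =
  (act_l XX - cross - lambda *: U) - (act_r XX - act_r YY - lambda *: V)
  - - (lambda * lambda) *: (one \ox one \ox psi (psi a)).
Proof.
(* These twists give each inner [Delta_r] under the sums an argument of the form
   [alpha (beta _)]. *)
rewrite (tmap_Delta _ _ _ (invariant_comp r_alpha r_beta) r_beta) /=.
rewrite Delta1 ptensZl scalerA mulrN; congr (_ - _ - _).
  rewrite lact_r13r12 /cross /U -one_l -ssumZ -!ssumB.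
  apply: eq_ssum => x y; rewrite -Delta_ptensl; congr (Delta_r _ \ox _).
  by rewrite /d !homM !homC.
rewrite ract_r13r12 ract_r12r23 /V -one_r -ssumZ -!ssumB.
by apply: eq_ssum => x y; rewrite -Delta_ptensl.
Qed.

Let coassoc_rhs : tassoc (tmap omega Delta_r (Delta_r a)) =
  (act_l YY - act_l ZZ - lambda *: act_l WW)
  - (cross - act_r ZZ - lambda *: act_r WW)
  - lambda *: (U - V - lambda *: (one \ox one \ox psi (psi a))).
Proof.
rewrite (tmap_Delta _ _ _ r_alpha (invariant_comp r_alpha r_beta)) /=.
rewrite linear_ssumBB omega1.
have psiC : psi (alpha (beta d)) = alpha (beta (psi d)) by rewrite !homC.
rewrite psiC /= Delta_ptensr -psiC; congr (_ - _ - _).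
  rewrite lact_r12r23 lact_r23r13 lact_r13 -ssumZ -!ssumB.
  by apply: eq_ssum => x y; rewrite -Delta_ptensr homC.
rewrite crossE ract_r23r13 ract_r13 -ssumZ -!ssumB.
apply: eq_ssum => x y; rewrite -Delta_ptensr; congr (tassoc (_ \ox Delta_r _)).
by rewrite /d !homM !homC.
Qed.

Lemma coassociativity_defect :
  tmap Delta_r psi (Delta_r a) - tassoc (tmap omega Delta_r (Delta_r a)) =
  act_l (aybe mu lambda one alpha beta psi omega (tens_of s))
  - act_r (aybe mu lambda one alpha beta psi omega (tens_of s)).
Proof.
rewrite coassoc_lhs coassoc_rhs /aybe.
set L := linear_of (lact_linear mu beta omega (omega (beta d))).
set R := linear_of (ract_linear mu alpha psi (psi (alpha d))).
rewrite -[act_l (_ + _)]/(L _) -[act_r (_ + _)]/(R _).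
rewrite [L _]linearD [L _]linearD [L (_ - _)]linearB [L (_ *: _)]linearZ.
rewrite [R _]linearD [R _]linearD [R (_ - _)]linearB [R (_ *: _)]linearZ /=.
rewrite !scalerBr !scaleNr !scalerA !opprD !opprK !addrA.
(* The first eight positions are the surviving terms in the order of the goal; the rest are four
   opposite pairs: [cross], the multiples of [U] and of [V], and the [lambda * lambda] terms. *)
by rewrite [LHS](ACl (1*8*9*10*4*5*12*13*11*2*14*3*6*15*7*16)) /= !addrK.
Qed.

End Terms.

End Coassociativity.

Theorem theorem3p14 (K : fieldType) (lambda : K) (A : lmodType K)
    (mu : {linear tens A A -> A}) (one : A)
    (alpha beta psi omega : {linear A -> A})
    (A_assoc : bihom_associative mu alpha beta)
    (A_unit : bihom_unit mu one alpha beta)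
    (alpha_bij : bijective alpha) (beta_bij : bijective beta)
    (alpha_psi : forall a, alpha (psi a) = psi (alpha a))
    (alpha_omega : forall a, alpha (omega a) = omega (alpha a))
    (beta_psi : forall a, beta (psi a) = psi (beta a))
    (beta_omega : forall a, beta (omega a) = omega (beta a))
    (psi_omega : forall a, psi (omega a) = omega (psi a))
    (psiM : multiplicative_for mu psi) (omegaM : multiplicative_for mu omega)
    (psi1 : psi one = one) (omega1 : omega one = one)
    (r : tens A A)
    (r_alpha : tmap alpha alpha r = r) (r_beta : tmap beta beta r = r)
    (r_psi : tmap psi psi r = r) (r_omega : tmap omega omega r = r) :
  let Delta_r : {linear A -> tens A A} :=
    Delta mu lambda one psi omega alpha_bij beta_bij r in
  let E : tens (tens A A) A := aybe mu lambda one alpha beta psi omega r in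
  bihom_derivation mu lambda alpha beta psi omega Delta_r /\
  (bihom_coassociative psi omega Delta_r <->
   forall a : A,
     lact mu beta omega (omega (linv alpha_bij a)) E =
     ract mu alpha psi E (psi (linv beta_bij a))).
Proof.
move=> Delta_r E; rewrite {}/Delta_r {}/E.
have [s rE] := tens_sum r.
rewrite {}rE -/(tens_of s) in r_alpha r_beta r_psi r_omega *.
split; first exact: Delta_derivation.
have defect c := coassociativity_defect lambda A_assoc A_unit alpha_bij beta_bij
  alpha_psi alpha_omega beta_psi beta_omega psi_omega psiM omegaM psi1 omega1
  r_alpha r_beta r_psi r_omega c.
(* Identifies the arguments of the two actions in the balance condition with those in [defect]. *)
have linvs d : linv alpha_bij (alpha (beta d)) = beta d /\
    linv beta_bij (alpha (beta d)) = alpha d.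
  by rewrite linvK (bihom_comm A_assoc) linvK.
split=> [coassoc a | balanced a].
  (* Surjectivity is used twice to reach the form [alpha (beta (alpha (beta c)))] at which [defect]
     is stated. *)
  have [d ->] := alpha_beta_surj alpha_bij beta_bij a.
  have [c ->] := alpha_beta_surj alpha_bij beta_bij d.
  have [-> ->] := linvs (alpha (beta c)).
  apply/eqP; rewrite -subr_eq0 -defect subr_eq0; apply/eqP; exact: coassoc.
have [d ->] := alpha_beta_surj alpha_bij beta_bij a.
have [c ->] := alpha_beta_surj alpha_bij beta_bij d.
apply/eqP; rewrite -subr_eq0 /= defect subr_eq0; apply/eqP.
have := balanced (alpha (beta (alpha (beta c)))).
by have [-> ->] := linvs (alpha (beta c)).
Qed.
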